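(* Let $x > 0$, let $h = \lambda \log x$ with $h = o(x)$, and let $r=r(x)$ be a positive integer with $r = o((\log x)^{1/3})$ as $x\to\infty$. Define \[ m_r(x,h) = \frac 1x \sum_{n \le x} \left(\pi(n + h) - \pi(n) \right)^r. \] Then \[ m_r(x,h) \ll \lambda^r r^{2r} e^{O(r \log \log r)}. \]
   Context: $\pi$ denotes the prime counting function. This statement is unconditional.
   Formalization: The formal theorem adds that λ is bounded below by a positive constant for all large x; without this the claim fails, e.g. for λ = 1/log x, h = 1, r = 2, where m_2 ~ 1/log x but the bound is O(1/log² x). *)

(* Defs.v *)
From HB Require Import structures.
From mathcomp Require Import all_boot all_order all_algebra.
From mathcomp Require Import all_classical all_reals all_analysis.

Set Implicit Arguments.
Unset Strict Implicit.
Unset Printing Implicit Defensive.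

Import Order.TTheory GRing.Theory Num.Theory.
Import numFieldNormedType.Exports.

Local Open Scope ring_scope.

(* Makes the filter [+oo] usable in the Landau notations [=o_+oo], [=O_+oo]. *)
Canonical pinfty_filter_on (R : numFieldType) :=
  FilterType (pinfty_nbhs R) (@filter_filter R _ proper_pinfty_nbhs).

(* [Num.truncn y] is the floor of [y], and [0%N] when [y < 0]. *)
Definition prime_pi (R : realType) (y : R) : nat :=
  count prime (iota 0 (Num.truncn y).+1).

(* [n] ranges over the positive integers up to [x]; the difference is taken in
   [R], so it is not truncated. *)
Definition prime_moment (R : realType) (r : nat) (x h : R) : R :=
  x^-1 * \sum_(1 <= n < (Num.truncn x).+1)
           ((prime_pi (n%:R + h))%:R - (prime_pi (n%:R : R))%:R) ^+ r.

(* Main.v *)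
(* A Selberg sieve by the primes 2^K >= p > 4r, with K of order (log x)/r, bounds
   the number of n <= x for which n + a_1, ..., n + a_r are all prime by
   2x * w(a) plus an error O(sqrt x), where
   w(a) = prod_p (1 - 1/p)^(nu_p(a)) and nu_p(a) is the number of distinct
   residues of the a_i modulo p.  Summing w over a_1, ..., a_r <= h one variable
   at a time, each new variable contributes a factor at most
   r + 4 h prod_p (1 - 1/p): the term r accounts for a repeated value; otherwise
   the factor is prod_p (1 - 1/p), up to a correction at the primes dividing some
   a_j - a_i, which AM-GM and p > 4r keep bounded on average.  Euler's product
   gives prod_p (1 - 1/p) <= 8r/K, which is O(r^2 / log x), so each variable
   contributes O(lambda r^2), and the r-th moment is at most
   C^r r^(2r) lambda^r. *)
Require Import Defs.
From HB Require Import structures.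
From mathcomp Require Import all_boot all_order all_algebra.
From mathcomp Require Import all_classical all_reals all_analysis.
From mathcomp Require Import ring lra zify.

Import Order.TTheory GRing.Theory Num.Theory.
Import numFieldNormedType.Exports.

Local Open Scope ring_scope.

(** * Sums of periodic functions *)

(** As [a] is prime to [b], [j * a + i] runs through every residue modulo [b] exactly once. *)
Lemma sum_coprime_progression (V : nmodType) (a b i : nat) (g : nat -> V) :
  (0 < b)%N -> coprime a b -> (forall n, g (n %% b)%N = g n) ->
  \sum_(0 <= j < b) g (j * a + i)%N = \sum_(0 <= j < b) g j.
Proof.
move=> b0 ab gP; rewrite !big_mkord.
pose h (j : 'I_b) : 'I_b := Ordinal (ltn_pmod (j * a + i) b0).
have hI : injective h.
  suff H (j j' : 'I_b) : (j <= j')%N -> h j = h j' -> j = j'.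
    move=> j j' e; case: (leqP j j') => [/H|/ltnW/H]; first exact.
    by move=> /(_ (esym e)) ->.
  move=> le /(congr1 val) /= /esym /eqP.
  rewrite eqn_modDr eqn_mod_dvd ?leq_mul2r ?le ?orbT // -mulnBl.
  rewrite Gauss_dvdl 1?coprime_sym // => /dvdn_leq d.
  apply/val_inj/eqP; rewrite eqn_leq le -subn_eq0 /=.
  case: posnP => // /d; have := ltn_ord j'; lia.
rewrite [RHS](reindex_inj hI) /=; apply: eq_bigr => j _ /=.
by rewrite gP.
Qed.

(** The Chinese remainder theorem for sums: writing [n = i + j * a] freezes [f] at [i], while [g]
    runs over a full residue system modulo [b]. *)
Lemma sum_periodic_coprime (R : pzRingType) (a b : nat) (f g : nat -> R) :
  (0 < a)%N -> (0 < b)%N -> coprime a b ->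
  (forall n, f (n %% a)%N = f n) -> (forall n, g (n %% b)%N = g n) ->
  \sum_(0 <= n < a * b) f n * g n =
  (\sum_(0 <= n < a) f n) * \sum_(0 <= n < b) g n.
Proof.
move=> a0 b0 ab fP gP; rewrite mulnC big_nat_mul /=.
under eq_big_nat => j _.
  rewrite mulSn -[X in \sum_(X <= _ < _) _]add0n big_addn addnK; over.
rewrite exchange_big /= mulr_suml; apply: eq_bigr => i _.
under eq_bigr => j _.
  have -> : f (i + j * a)%N = f i by rewrite -fP addnC modnMDl fP.
  rewrite addnC; over.
by rewrite -mulr_sumr sum_coprime_progression.
Qed.

Lemma coprime_prodl (I : eqType) (s : seq I) (p : I -> nat) (m : nat) :
  (forall i, i \in s -> coprime (p i) m) -> coprime (\prod_(i <- s) p i) m.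
Proof.
move=> H; rewrite big_seq; apply: (big_ind (fun n => coprime n m)) => //.
  exact: coprime1n.
by move=> x y; rewrite coprimeMl => -> ->.
Qed.

Lemma dvdn_prod_coprime (I : eqType) (s : seq I) (p : I -> nat) (m : nat) :
  uniq s -> {in s &, forall i j, i != j -> coprime (p i) (p j)} ->
  (forall i, i \in s -> p i %| m)%N -> (\prod_(i <- s) p i %| m)%N.
Proof.
elim: s => [|i s IH] /=; first by rewrite big_nil dvd1n.
move=> /andP[iNs us] pc dv; rewrite big_cons Gauss_dvd.
  rewrite dv ?mem_head // IH // => [j l js ls|j js].
    by apply: pc; rewrite in_cons ?js ?ls orbT.
  by rewrite dv // in_cons js orbT.
rewrite coprime_sym; apply: coprime_prodl => j js.
apply: pc; rewrite ?mem_head ?in_cons ?js ?orbT //.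
by apply: contraNneq iNs => <-.
Qed.

(** Reduces correlations of the sieve functions to sums modulo one [p i] at a time. *)
Lemma sum_prod_periodic (R : comPzRingType) (I : eqType) (s : seq I)
    (p : I -> nat) (f : I -> nat -> R) :
  uniq s -> (forall i, 0 < p i)%N ->
  (forall i j, i != j -> coprime (p i) (p j)) ->
  (forall i n, f i (n %% p i)%N = f i n) ->
  \sum_(0 <= n < \prod_(i <- s) p i) \prod_(i <- s) f i n =
  \prod_(i <- s) \sum_(0 <= n < p i) f i n.
Proof.
move=> + p0 pc fP; elim: s => [|i s IH] /=.
  by rewrite !big_nil big_nat1 big_nil.
move=> /andP[iNs /IH {}IH]; rewrite !big_cons.
under eq_bigr => n _ do rewrite big_cons.
rewrite sum_periodic_coprime ?IH //.
- by rewrite prodn_gt0.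
- rewrite coprime_sym; apply: coprime_prodl => j js.
  by apply/pc; apply: contraNneq iNs => <-.
- move=> n; rewrite [LHS]big_seq [RHS]big_seq; apply: eq_bigr => j js.
  by rewrite -[LHS]fP modn_dvdm ?fP// (big_rem j)//= dvdn_mulr.
Qed.

(** Full periods contribute the mean; the incomplete one has fewer than [W] terms, each at most 1. A
    nonnegative mean lets the number of full periods be replaced by [N / W]. *)
Lemma sum_periodic_le (R : realFieldType) (W N : nat) (phi : nat -> R) :
  (0 < W)%N -> (forall n, phi (n %% W)%N = phi n) -> (forall n, phi n <= 1) ->
  0 <= \sum_(0 <= n < W) phi n ->
  \sum_(0 <= n < N) phi n
    <= N%:R * ((\sum_(0 <= n < W) phi n) / W%:R) + W%:R.
Proof.
move=> W0 phiP phi1 S0; rewrite {1}(divn_eq N W).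
rewrite (big_cat_nat (n := N %/ W * W)) ?leq_addr //= lerD //.
  rewrite big_nat_mul /=.
  under eq_big_nat => j _.
    rewrite mulSn -[X in \sum_(X <= _ < _) _]add0n big_addn addnK.
    under eq_bigr => i _ do rewrite -phiP addnC modnMDl phiP.
    over.
  rewrite sumr_const_nat subn0 -[leLHS]mulr_natl mulrA mulrAC ler_wpM2r //.
  by rewrite ler_pdivlMr ?ltr0n // -natrM ler_nat leq_divM.
apply: le_trans (ler_sum_nat (fun n _ => phi1 n)) _.
rewrite sumr_const_nat addKn ler_nat.
exact/ltnW/ltn_pmod.
Qed.

(** * Selberg's upper-bound sieve *)

Section Selberg.
Variables (R : realFieldType) (I : finType) (p : I -> nat).
Variables (bad : I -> pred nat) (k : I -> nat) (M : nat).

Definition nbad (i : I) : nat := \sum_(0 <= n < p i) bad i n.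

Hypothesis p_coprime : forall i j, i != j -> coprime (p i) (p j).
Hypothesis bad_mod : forall i n, bad i (n %% p i)%N = bad i n.
Hypothesis nbad_gt0 : forall i, (0 < nbad i)%N.
Hypothesis nbad2 : forall i, (2 * nbad i <= p i)%N.
Hypothesis pk : forall i, (p i <= 2 ^ k i)%N.

Let p_gt1 i : (1 < p i)%N.
Proof. by have := nbad_gt0 i; have := nbad2 i; lia. Qed.

Let p_gt0 i : (0 < p i)%N. Proof. exact: ltnW. Qed.

(** Selberg's multiplicative function, for which [g / (1 + g)] is the proportion of bad residues. *)
Let g (i : I) : R := (nbad i)%:R / ((p i)%:R - (nbad i)%:R).

(* Orthogonal to the constants in [L^2(Z/p)]: Selberg's majorant is written in
   the products of these functions, where it is diagonal, instead of in the
   usual weights [lambda_d]. *)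
Let psi (i : I) (n : nat) : R := if bad i n then - (g i)^-1 else 1.

(** The level is measured additively through the exponents [k]: moduli stay at most [2 ^ M], and
    membership is a bound on a sum, to which Markov's inequality applies. *)
Let family : {set {set I}} := [set A : {set I} | (\sum_(i in A) k i <= M)%N].

Let nuR i : 0 < (nbad i)%:R :> R. Proof. by rewrite ltr0n. Qed.

Let dR i : (nbad i)%:R <= (p i)%:R - (nbad i)%:R :> R.
Proof. by have := nbad2 i; rewrite -(ler_nat R) natrM; lra. Qed.

Let g_gt0 i : 0 < g i.
Proof. by rewrite divr_gt0 //; have := nuR i; have := dR i; lra. Qed.

Let g_le1 i : g i <= 1.
Proof.
by rewrite ler_pdivrMr ?mul1r //; have := nuR i; have := dR i; lra.
Qed.

(** The value is -1 on bad residues and [g i] elsewhere, which [nbad2] keeps at most 1. *)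
Let norm_gpsi i n : `|g i * psi i n| <= 1.
Proof.
rewrite /psi; case: ifP => _; last by rewrite mulr1 gtr0_norm.
by rewrite mulrN normrN divff ?normr1 // gt_eqF.
Qed.

Let psi_mod i n : psi i (n %% p i)%N = psi i n.
Proof. by rewrite /psi bad_mod. Qed.

Let sum_if_bad i (x y : R) :
  \sum_(0 <= n < p i) (if bad i n then x else y) =
  (nbad i)%:R * x + ((p i)%:R - (nbad i)%:R) * y.
Proof.
have E n : (if bad i n then x else y) = y + (bad i n)%:R * (x - y).
  by case: bad; rewrite ?mul1r ?mul0r; ring.
under eq_bigr do rewrite E.
rewrite big_split /= -mulr_suml sumr_const_nat subn0 -natr_sum -/(nbad i).
by rewrite -mulr_natl; ring.
Qed.

Let sum_gpsi i : \sum_(0 <= n < p i) g i * psi i n = 0.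
Proof.
rewrite -mulr_sumr sum_if_bad /g.
have := nuR i; have := dR i => d1 d2; field.
by rewrite !gt_eqF // (lt_le_trans d2).
Qed.

Let sum_gpsi2 i :
  \sum_(0 <= n < p i) (g i * psi i n) * (g i * psi i n) = (p i)%:R * g i.
Proof.
have E n : g i * psi i n * (g i * psi i n) = if bad i n then 1 else g i ^+ 2.
  rewrite /psi; case: ifP => _; last by ring.
  by field; rewrite gt_eqF.
under eq_bigr do rewrite E.
rewrite sum_if_bad /g.
have := nuR i; have := dR i => d1 d2; field.
by rewrite gt_eqF // (lt_le_trans d2).
Qed.

Let modulus (A : {set I}) : nat := \prod_(i in A) p i.

Let modulus_gt0 A : (0 < modulus A)%N. Proof. by rewrite prodn_cond_gt0. Qed.

Let modulus_le A : A \in family -> (modulus A <= 2 ^ M)%N.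
Proof.
rewrite inE => AM; apply: leq_trans (_ : 2 ^ (\sum_(i in A) k i) <= _)%N.
  by rewrite expn_sum leq_prod.
by rewrite leq_exp2l.
Qed.

Let mem_modulus (A : {set I}) i : (i \in A) = (p i %| modulus A)%N.
Proof.
case: (boolP (i \in A)) => iA; first by rewrite /modulus (bigD1 i) //= dvdn_mulr.
have : coprime (p i) (modulus A).
  rewrite coprime_sym /modulus -big_enum; apply: coprime_prodl => j.
  by rewrite mem_enum => jA; apply/p_coprime; apply: contraNneq iA => <-.
move=> co; apply/esym/negbTE; apply/negP => /gcdn_idPl e.
by move: co; rewrite /coprime e => /eqP e1; have := p_gt1 i; rewrite e1.
Qed.

Let modulus_inj : injective modulus.
Proof. by move=> A B e; apply/finset.setP => i; rewrite !mem_modulus e. Qed.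

(** A set is recovered from its modulus, so the family injects into the integers from 1 to
    [2 ^ M]. *)
Let card_family : (#|family| <= 2 ^ M)%N.
Proof.
rewrite cardE -(size_map modulus) -[leqRHS](size_iota 1).
apply: uniq_leq_size; first by rewrite map_inj_uniq ?enum_uniq.
move=> _ /mapP[A + ->]; rewrite mem_enum => /modulus_le le.
by rewrite mem_iota modulus_gt0 add1n ltnS.
Qed.

Let G (A : {set I}) : R := \prod_(i in A) g i.

Let Psi (A : {set I}) (n : nat) : R := \prod_(i in A) (g i * psi i n).

Let factor (A B : {set I}) (i : I) (n : nat) : R :=
  (if i \in A then g i * psi i n else 1) *
  (if i \in B then g i * psi i n else 1).

Let PsiM A B n : Psi A n * Psi B n = \prod_(i in A :|: B) factor A B i n.
Proof.
rewrite big_split /= /Psi; congr (_ * _).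
  rewrite -big_mkcondr /=; apply: eq_bigl => i; rewrite inE.
  by case: (i \in A); rewrite ?andbF.
rewrite -big_mkcondr /=; apply: eq_bigl => i; rewrite inE.
by case: (i \in B); rewrite ?andbF ?orbT.
Qed.

Let factor_mod A B i n : factor A B i (n %% p i)%N = factor A B i n.
Proof. by rewrite /factor psi_mod. Qed.

(** Orthogonality: an index lying in only one of the two sets contributes a factor of mean zero
    ([sum_gpsi]); on the diagonal, [sum_gpsi2] gives the norms. *)
Let sum_PsiM A B :
  \sum_(0 <= n < modulus (A :|: B)) Psi A n * Psi B n =
  if A == B then (modulus A)%:R * G A else 0.
Proof.
under eq_bigr do rewrite PsiM -big_enum.
rewrite /modulus -big_enum sum_prod_periodic ?enum_uniq // big_enum /=.
case: eqP => [<-|/eqP neq].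
  rewrite finset.setUid natr_prod /G -big_split /=; apply: eq_bigr => i iA.
  by rewrite -sum_gpsi2; apply: eq_bigr => n _; rewrite /factor iA.
have [i iAB dif] : exists2 i, i \in A :|: B & (i \in A) != (i \in B).
  apply/exists_inP; apply: contraNT neq => /exists_inPn H.
  apply/eqP/setP => i; have := H i; rewrite inE.
  by case: (i \in A) (i \in B) => [] [] // /(_ isT).
rewrite (bigD1 i) //= (_ : \sum_(_ <= _ < _) _ = 0) ?mul0r //.
rewrite -[RHS](sum_gpsi i); apply: eq_bigr => n _; rewrite /factor.
by case: (i \in A) (i \in B) dif => [] []; rewrite ?mulr1 ?mul1r.
Qed.

Let PsiM_le1 A B n : Psi A n * Psi B n <= 1.
Proof.
apply: le_trans (ler_norm _) _; rewrite normrM !normr_prod.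
by rewrite mulr_ile1 ?prodr_ge0 // prodr_ile1 // => i _; rewrite normr_ge0 norm_gpsi.
Qed.

Let G_ge0 A : 0 <= G A.
Proof. by apply: prodr_ge0 => i _; apply: ltW. Qed.

(** The error is one period, and the modulus of a union is at most the product of the two moduli. *)
Let partial_PsiM N A B : A \in family -> B \in family ->
  \sum_(0 <= n < N) Psi A n * Psi B n
    <= N%:R * (if A == B then G A else 0) + (2 ^ M)%:R ^+ 2.
Proof.
move=> fA fB.
have Wmod n : Psi A (n %% modulus (A :|: B))%N * Psi B (n %% modulus (A :|: B))%N
              = Psi A n * Psi B n.
  rewrite !PsiM; apply: eq_bigr => i iAB.
  by rewrite -[LHS]factor_mod modn_dvdm ?factor_mod // -mem_modulus.
apply: le_trans (sum_periodic_le R _ N _ (modulus_gt0 (A :|: B)) Wmod (PsiM_le1 A B) _) _.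
  by rewrite sum_PsiM; case: ifP => // _; rewrite mulr_ge0.
apply: lerD; last first.
  rewrite -natrX ler_nat; apply: leq_trans (_ : modulus A * modulus B <= _)%N.
    rewrite /modulus [X in (X <= _)%N]big_mkcond [X in (_ <= X * _)%N]big_mkcond.
    rewrite [X in (_ <= _ * X)%N]big_mkcond -big_split /=.
    apply: leq_prod => i _; rewrite inE.
    by case: (i \in A) (i \in B) => [] []; rewrite //= ?muln1 ?mul1n // leq_pmulr.
  by rewrite -mulnn leq_mul ?modulus_le.
rewrite ler_wpM2l // sum_PsiM; case: ifP => [/eqP <-|_]; last by rewrite mul0r.
by rewrite finset.setUid mulrAC divff ?mul1r // pnatr_eq0 -lt0n.
Qed.

Let L : R := \sum_(A in family) G A.

Let set0_family : finset.set0 \in family.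
Proof. by rewrite inE big_set0. Qed.

Let L_ge1 : 1 <= L.
Proof.
rewrite /L (bigD1 finset.set0) //= {1}/G big_set0 lerDl.
by apply: sumr_ge0.
Qed.

Let sifted (n : nat) : bool := [forall i, ~~ bad i n].

Let sifted_L n : sifted n -> \sum_(A in family) Psi A n = L.
Proof.
move=> /forallP H; apply: eq_bigr => A _; apply: eq_bigr => i _.
by rewrite /psi (negbTE (H i)) mulr1.
Qed.

(** The square of the sum of the [Psi A] is nonnegative everywhere and equals [L ^+ 2] on sifted
    integers. Once expanded, its diagonal gives [N * L], and each of at most [(2 ^ M) ^ 2] pairs
    costs an error [(2 ^ M) ^ 2]. *)
Let selberg_quadratic N :
  (\sum_(0 <= n < N) sifted n)%:R * L ^+ 2 <= N%:R * L + (2 ^ M)%:R ^+ 4.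
Proof.
apply: le_trans (_ : \sum_(0 <= n < N) (\sum_(A in family) Psi A n) ^+ 2 <= _).
  rewrite natr_sum mulr_suml; apply: ler_sum => n _.
  case: (boolP (sifted n)) => [/sifted_L ->|_]; rewrite ?mul1r //.
  by rewrite mul0r sqr_ge0.
under eq_bigr do rewrite expr2 mulr_suml.
rewrite exchange_big /=.
under eq_bigr => A _.
  under eq_bigr do rewrite mulr_sumr.
  rewrite exchange_big /=; over.
pose B1 (A B : {set I}) : R :=
  N%:R * (if A == B then G A else 0) + (2 ^ M)%:R ^+ 2.
apply: le_trans (_ : \sum_(A in family) \sum_(B in family) B1 A B <= _).
  by apply: ler_sum => A fA; apply: ler_sum => B fB; apply: partial_PsiM.
rewrite /B1; under eq_bigr => A fA.
  rewrite big_split /= -mulr_sumr (bigD1 A) //= eqxx big1 ?addr0; last first.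
    by move=> B /andP[_]; rewrite eq_sym => /negbTE ->.
  rewrite sumr_const; over.
rewrite big_split /= -mulr_sumr lerD2l sumr_const -[X in X <= _]mulr_natl.
rewrite -[_ ^+ 2 *+ _]mulr_natl mulrA (_ : 4 = 2 + 2)%N // exprD.
by rewrite ler_wpM2r ?sqr_ge0 // expr2 ler_pM // ler_nat.
Qed.

Let selberg_sieve N :
  (\sum_(0 <= n < N) sifted n)%:R <= N%:R / L + (2 ^ M)%:R ^+ 4.
Proof.
have L0 : 0 < L by apply: lt_le_trans L_ge1.
rewrite -(ler_pM2r (_ : 0 < L ^+ 2)) ?exprn_gt0 //.
apply: le_trans (selberg_quadratic N) _; rewrite mulrDl lerD //.
  by rewrite expr2 mulrA divfK // gt_eqF.
by rewrite ler_peMr ?exprn_ge0 // exprn_ege1.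
Qed.

(** * Lower bound for the sieve denominator *)

Hypothesis M_gt0 : (0 < M)%N.
Hypothesis mean_k :
  2 * \sum_i (k i)%:R * ((nbad i)%:R / (p i)%:R) <= M%:R :> R.

Let T : R := \prod_i (1 + g i).

Let frac_g i : g i / (1 + g i) = (nbad i)%:R / (p i)%:R.
Proof.
have d0 : (p i)%:R - (nbad i)%:R != 0 :> R.
  by rewrite gt_eqF // (lt_le_trans (nuR i)).
rewrite /g -[X in _ / (X + _)](divff d0) -mulrDl subrK invfM invrK.
by rewrite [(p i)%:R^-1 * _]mulrC mulrA divfK.
Qed.

Let sum_G : \sum_A G A = T.
Proof.
rewrite /T; under [RHS]eq_bigr do rewrite addrC.
rewrite bigA_distr /=; apply: eq_bigr => A _.
by rewrite /G big_mkcond.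
Qed.

(** Under the probabilities [G A / T] the indices are independent, and [i] is chosen with
    probability [g i / (1 + g i)]. *)
Let sum_G_mem i : \sum_(A : {set I} | i \in A) G A = T * (g i / (1 + g i)).
Proof.
have g1 : 1 + g i != 0 by rewrite gt_eqF // addr_gt0.
rewrite /T (bigD1 i) //= mulrAC [(1 + g i) * _]mulrC divfK //.
(* Replacing [1 + g i] by [g i] in the product discards the sets that omit [i]. *)
transitivity (\prod_j (g j + (if j == i then 0 else 1))); last first.
  rewrite (bigD1 i) //= eqxx addr0; congr (_ * _).
  by apply: eq_bigr => j /negbTE ->; rewrite addrC.
rewrite bigA_distr big_mkcond /=; apply: eq_bigr => A _.
case: (boolP (i \in A)) => iA.
  rewrite /G big_mkcond /=; apply: eq_bigr => j _; case: ifP => // jA.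
  by case: eqP => // e; rewrite e iA in jA.
by rewrite (bigD1 i) //= (negbTE iA) eqxx mul0r.
Qed.

(* Markov's inequality for [sum_(i in A) k i], the random set [A] having
   probability [G A / T]. *)
Let L_ge_half : T / 2 <= L.
Proof.
have T0 : 0 <= T by apply: prodr_ge0 => i _; rewrite addr_ge0 // ltW.
have TL : T - L = \sum_(A | A \notin family) G A.
  by apply/eqP; rewrite subr_eq addrC -sum_G (bigID (mem family)).
have : M%:R * (T - L) <= M%:R * (T / 2).
  rewrite TL.
  apply: le_trans (_ : \sum_(A : {set I}) (\sum_(i in A) k i)%N%:R * G A <= _).
    rewrite mulr_sumr [leRHS](bigID (mem family)) /= -[leLHS]add0r lerD //.
      by apply: sumr_ge0 => A _; rewrite mulr_ge0.
    apply: ler_sum => A; rewrite inE -ltnNge => /ltnW MA.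
    by rewrite ler_wpM2r // ler_nat.
  under eq_bigr => A _.
    rewrite natr_sum mulr_suml big_mkcond /=; over.
  rewrite exchange_big /=.
  under eq_bigr => i _.
    rewrite -big_mkcond /= -mulr_sumr sum_G_mem frac_g mulrCA; over.
  by rewrite -mulr_sumr; have := ler_wpM2l T0 mean_k; lra.
rewrite ler_pM2l ?ltr0n //; lra.
Qed.

(** [T / 2 <= L] turns [N / L] into [2 * N / T], and [T^-1] is the product of the densities of the
    good residues. *)
Theorem sieve_upper_bound (N : nat) :
  (\sum_(0 <= n < N) [forall i, ~~ bad i n])%:R
    <= 2 * N%:R * \prod_i (1 - (nbad i)%:R / (p i)%:R) + (2 ^ (4 * M))%:R :> R.
Proof.
have TE : T^-1 = \prod_i (1 - (nbad i)%:R / (p i)%:R).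
  rewrite /T -prodfV; apply: eq_bigr => i _; rewrite -frac_g.
  by field; rewrite gt_eqF // addr_gt0.
have T0 : 0 < T by apply: prodr_gt0 => i _; rewrite addr_gt0.
apply: le_trans (selberg_sieve N) _.
rewrite lerD //; last by rewrite -natrX ler_nat -expnM mulnC.
rewrite -TE [2 * _]mulrC -mulrA ler_wpM2l //.
have L0 : 0 < L by apply: lt_le_trans L_ge1.
rewrite -[leRHS]invrK invfM invrK lef_pV2 ?posrE ?mulr_gt0 ?invr_gt0 //.
by rewrite mulrC L_ge_half.
Qed.

End Selberg.

(** * Prime tuples on average *)

Lemma AGM_prod_le (R : realFieldType) (t : seq R) :
  all (fun x => 0 <= x) t ->
  (size t)%:R * \prod_(x <- t) x <= \sum_(x <- t) x ^+ size t.
Proof.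
have [/size0nil ->|n0 /(all_nthP 0) t0] := posnP (size t).
  by rewrite mul0r big_nil.
rewrite (big_nth 0) [leRHS](big_nth 0) !big_mkord.
pose E (i : 'I_(size t)) : R := t`_i ^+ size t.
have E0 : {in 'I_(size t), forall i, 0 <= E i}.
  by move=> i _; rewrite exprn_ge0 // t0.
have := (leif_AGM E0).1; rewrite card_ord prodrXl ler_pXn2r ?nnegrE //.
- by rewrite ler_pdivlMr ?ltr0n // mulrC.
- by apply: prodr_ge0 => i _; rewrite t0.
- by rewrite divr_ge0 // sumr_ge0.
Qed.

(** Padding with ones to length [r] makes the exponent [r] whatever the size of [t]. *)
Lemma AGM_prod_le_pad (R : realFieldType) (r : nat) (t : seq R) :
  (size t <= r)%N -> all (fun x => 0 <= x) t ->
  r%:R * \prod_(x <- t) x <= \sum_(x <- t) x ^+ r + (r - size t)%:R.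
Proof.
move=> tr t0; have := AGM_prod_le _ (t ++ nseq (r - size t) 1).
rewrite all_cat t0 all_nseq ler01 orbT size_cat size_nseq subnKC // => /(_ isT).
rewrite !big_cat /= !big_nseq expr1n !iter_addr_0 iter_mulr_1 expr1n mulr1.
by [].
Qed.

Lemma bernoulli_le (R : realFieldType) (x : R) (n : nat) :
  0 <= x <= 1 -> 1 - n%:R * x <= (1 - x) ^+ n.
Proof.
move=> /andP[x0 x1]; elim: n => [|n IH]; first by rewrite mul0r subr0 expr0.
rewrite exprS -natr1.
have := ler_wpM2l (_ : 0 <= 1 - x) IH; rewrite subr_ge0 x1 => /(_ isT).
apply: le_trans.
have : 0 <= n%:R * x * x by rewrite !mulr_ge0.
lra.
Qed.

(** In the induction the cross term is at most [b i], because the remaining sum is at most 1/2. *)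
Lemma prod_1D_le (R : realFieldType) (I : Type) (s : seq I) (b : I -> R) :
  (forall i, 0 <= b i) -> \sum_(i <- s) b i <= 2^-1 ->
  \prod_(i <- s) (1 + b i) <= 1 + 2 * \sum_(i <- s) b i.
Proof.
move=> b0; elim: s => [|i s IH]; first by rewrite !big_nil; lra.
rewrite !big_cons => le; have bi := b0 i.
have s0 : 0 <= \sum_(j <- s) b j by apply: sumr_ge0.
have := ler_wpM2l (_ : 0 <= 1 + b i) (IH _); rewrite addr_ge0 // => /(_ isT).
move=> H; apply: le_trans (H _) _; first by lra.
nra.
Qed.

Lemma sum_dvd_shift (p a : nat) : (0 < p)%N ->
  (\sum_(0 <= n < p) (p %| n + a) = 1)%N.
Proof.
move=> p0.
have H := sum_coprime_progression nat 1 p a (fun n => nat_of_bool (p %| n)%N) p0.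
transitivity (\sum_(0 <= n < p) (p %| n))%N.
  rewrite -[RHS]H ?coprime1n //; first by apply: eq_bigr => n _; rewrite muln1.
  by move=> n; rewrite /dvdn modn_mod.
rewrite -(prednK p0) big_nat_recl // dvdn0 big_nat big1 ?addn0 // => n np.
by rewrite prednK // gtnNdvd //; lia.
Qed.

(** With truncated subtraction, the sum of the two differences is the distance between [a] and
    [b]. *)
Lemma eqn_mod_distn (p a b : nat) :
  (a == b %[mod p]) = (p %| (a - b) + (b - a))%N.
Proof.
case: (leqP a b) => [ab|/ltnW ab].
  by rewrite eq_sym eqn_mod_dvd // (eqP ab).
by rewrite eqn_mod_dvd // (eqP ab) addn0.
Qed.

Section Tuples.
Variables (R : realFieldType) (I : finType) (p : I -> nat) (r : nat).
Hypothesis p_inj : injective p.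
Hypothesis p_prime : forall i, prime (p i).
Hypothesis p_large : forall i, (4 * r < p i)%N.
Hypothesis r_gt0 : (0 < r)%N.

Definition hit (s : seq nat) (i : I) (n : nat) : bool :=
  has (fun a => p i %| n + a)%N s.

(** This is [nu_p]: the bad classes modulo [p i] are those of the [- a] for [a] in [s], as many as
    there are distinct residues in [s]. *)
Definition nhit (s : seq nat) (i : I) : nat := nbad I p (hit s) i.

Let p_gt0 i : (0 < p i)%N. Proof. exact: prime_gt0. Qed.

Lemma hit_mod s i n : hit s i (n %% p i)%N = hit s i n.
Proof. by apply: eq_has => a; rewrite /dvdn modnDml. Qed.

Lemma nhit_nil i : nhit [::] i = 0%N.
Proof. by rewrite /nhit /nbad big1. Qed.

Lemma nhit_cons a s i :
  nhit (a :: s) i = (nhit s i + ~~ has (fun b => a == b %[mod p i]) s)%N.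
Proof.
rewrite /nhit /nbad; case: hasP => [[b bs ab]|fresh] /=.
  rewrite addn0; apply: eq_bigr => n _; congr nat_of_bool; rewrite /hit /=.
  case: (boolP (p i %| n + a)%N) => // na; apply/esym/hasP; exists b => //.
  by move: na; rewrite /dvdn -modnDmr (eqP ab) modnDmr.
rewrite -(sum_dvd_shift (p i) a) // -big_split /=; apply: eq_bigr => n _.
rewrite /hit /=; case: (boolP (p i %| n + a)%N) => na /=; last by rewrite addn0.
rewrite (_ : has _ s = false) //; apply/negbTE/hasP => -[b bs nb].
apply: fresh; exists b => //.
by rewrite -(eqn_modDl n) (eqP na : _ = _) (eqP nb : _ = _).
Qed.

Lemma nhit_le s i : (nhit s i <= size s)%N.
Proof.
elim: s => [|a s IH]; first by rewrite nhit_nil.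
by rewrite nhit_cons /= -addn1 leq_add // leq_b1.
Qed.

Lemma nhit_gt0 s i : (0 < size s)%N -> (0 < nhit s i)%N.
Proof.
elim: s => // a [|b s] IH _; first by rewrite nhit_cons nhit_nil.
by rewrite nhit_cons ltn_addr // IH.
Qed.

Let q (i : I) : R := 1 - (p i)%:R^-1.

Let pV i : ((0 : R) < (p i)%:R^-1) && ((p i)%:R^-1 <= 1 :> R).
Proof. by rewrite invr_gt0 ltr0n p_gt0 invf_le1 ?ler1n ?ltr0n p_gt0. Qed.

Let q_gt0 i : 0 < q i.
Proof.
by rewrite subr_gt0 invf_lt1 ?ltr1n ?ltr0n // prime_gt1.
Qed.

Let q_le1 i : q i <= 1.
Proof. by rewrite gerBl; case/andP: (pV i) => /ltW. Qed.

(** The sieve produces [1 - nhit / p]; the power that dominates it by [bernoulli_le] changes by a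
    simple factor when an entry is added. *)
Definition tuple_weight (s : seq nat) : R :=
  \prod_i (1 - (p i)%:R^-1) ^+ nhit s i.

Lemma tuple_weight_ge0 s : 0 <= tuple_weight s.
Proof. by apply: prodr_ge0 => i _; rewrite exprn_ge0 // ltW // q_gt0. Qed.

Lemma coprime_primes i j : i != j -> coprime (p i) (p j).
Proof.
move=> ij; rewrite prime_coprime // dvdn_prime2 //.
by apply: contraNneq ij => /p_inj ->.
Qed.

(** * Average effect of a new entry *)

Let V : R := \prod_i (1 - (p i)%:R^-1).

Let V_ge0 : 0 <= V. Proof. by apply: prodr_ge0 => i _; rewrite ltW // q_gt0. Qed.

(** For [m > 0], the part of [m / phi(m)] that comes from the primes [p i]. *)
Let d (m : nat) : R := \prod_(i | (p i %| m)%N) (q i)^-1.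

Let d_ge1 m : 1 <= d m.
Proof.
apply: (big_ind (fun x => 1 <= x)) => // [x y|i _].
  by move=> x1 y1; rewrite mulr_ege1.
by rewrite -[leLHS]invr1 lef_pV2 ?posrE // q_gt0.
Qed.

Hypothesis sum_invsq : (4 * r)%:R * \sum_i ((p i)%:R ^- 2) <= 1 :> R.

(** [d m ^+ r] is the product of [1 + a i] over the [p i] dividing [m]. Expanded over sets of
    primes, each set only sees the multiples of its product and contributes at most [H] times the
    product of its [a i / p i]. As [a i <= 2 * r / p i], [sum_invsq] keeps the total below
    [2 * H]. *)
Let sum_d_le H : \sum_(1 <= m < H.+1) d m ^+ r <= 2 * H%:R.
Proof.
pose a i : R := (q i)^-1 ^+ r - 1.
have a0 i : 0 <= a i.
  rewrite subr_ge0 exprn_ege1 // -[leLHS]invr1 lef_pV2 ?posrE //; exact: q_gt0.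
have aP i : a i <= 2 * r%:R / (p i)%:R.
  have pi0 : 0 < (p i)%:R :> R by rewrite ltr0n.
  have rp : r%:R / (p i)%:R <= 4^-1 :> R.
    rewrite ler_pdivrMr //; have := p_large i.
    by rewrite -(ltr_nat R) natrM; lra.
  have r0 : 0 <= r%:R / (p i)%:R :> R by rewrite divr_ge0.
  have := bernoulli_le R (p i)%:R^-1 r; rewrite ltW ?invr_gt0 //=.
  rewrite (andP (pV i)).2 => /(_ isT); rewrite -/(q i) => B.
  rewrite -mulrA; move: (r%:R / _) r0 rp B => t t0 t4 B.
  (* For [t = r / p <= 1/4], [(1 - t) * (2 * t + 1) >= 1], which inverts Bernoulli's inequality. *)
  have t1 : 0 < 2 * t + 1 by lra.
  rewrite /a lerBlDr exprVn -[leRHS]invrK lef_pV2 ?posrE ?invr_gt0 ?exprn_gt0 //.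
    by apply: le_trans B; rewrite -[leLHS]mul1r ler_pdivrMr //; nra.
have dE m : d m ^+ r = \prod_i (1 + a i * (p i %| m)%N%:R).
  rewrite /d -prodrXl big_mkcond; apply: eq_bigr => i _.
  by case: ifP => _; rewrite ?mulr1 ?mulr0 ?addr0 // /a addrC subrK.
under eq_bigr => m _.
  rewrite dE; under eq_bigr do rewrite addrC.
  rewrite bigA_distr /=; over.
rewrite exchange_big /=.
apply: le_trans (_ : \sum_(A : {set I}) H%:R * \prod_(i in A) (a i / (p i)%:R) <= _).
  apply: ler_sum => A _; pose W := (\prod_(i in A) p i)%N.
  have W0 : (0 < W)%N by rewrite prodn_cond_gt0.
  apply: le_trans (_ : \sum_(1 <= m < H.+1) (W %| m)%N%:R * \prod_(i in A) a i <= _).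
    apply: ler_sum_nat => m _.
    rewrite -big_mkcond /= big_split /= mulrC ler_wpM2r ?prodr_ge0 //.
    case: (boolP (W %| m)%N) => [Wm|].
      rewrite big1 // => i iA; rewrite (dvdn_trans _ Wm) //.
      by rewrite /W (bigD1 i) //= dvdn_mulr.
    move=> Wm.
    suff /existsP[i /andP[iA /negbTE im]] :
        [exists i, (i \in A) && ~~ (p i %| m)%N].
      by rewrite (bigD1 i) //= im mul0r.
    apply: contraNT Wm => /existsPn H1; rewrite /W -big_enum.
    apply: dvdn_prod_coprime; first exact: enum_uniq.
      by move=> i j _ _; apply: coprime_primes.
    by move=> i; rewrite mem_enum => iA; have := H1 i; rewrite iA negbK.
  rewrite -mulr_suml -natr_sum -divn_count_dvd big_split /= mulrCA mulrC.
  rewrite ler_wpM2l ?prodr_ge0 // prodfV -natr_prod ler_pdivlMr ?ltr0n //.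
  by rewrite -natrM ler_nat leq_divM.
have b0 i : 0 <= a i / (p i)%:R by rewrite divr_ge0.
have sb : \sum_i a i / (p i)%:R <= 2^-1.
  apply: le_trans (_ : \sum_i 2 * r%:R * (p i)%:R ^- 2 <= _).
    apply: ler_sum => i _; by rewrite expr2 invfM mulrA ler_wpM2r ?invr_ge0.
  by rewrite -mulr_sumr; have := sum_invsq; rewrite natrM; lra.
have -> : \sum_(A : {set I}) H%:R * \prod_(i in A) (a i / (p i)%:R)
          = H%:R * \prod_i (1 + a i / (p i)%:R).
  under [in RHS]eq_bigr do rewrite addrC.
  rewrite bigA_distr mulr_sumr; apply: eq_bigr => A _.
  by rewrite big_mkcond.
rewrite mulrC ler_wpM2r //; apply: le_trans (prod_1D_le _ _ _ _ b0 sb) _.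
by rewrite [leRHS](_ : _ = 1 + 1) // lerD2l; lra.
Qed.

Let dist (a b : nat) : nat := ((a - b) + (b - a))%N.

Let sum_d_mono H c : (c <= H.+1)%N ->
  \sum_(1 <= m < c) d m ^+ r <= 2 * H%:R.
Proof.
move=> cH; apply: le_trans (sum_d_le H).
have d0 m : 0 <= d m ^+ r by rewrite exprn_ge0 // (le_trans _ (d_ge1 m)).
case: (leqP 1 c) => c1; last by rewrite big_geq ?sumr_ge0 // ltnW.
by rewrite [leRHS](big_cat_nat c1 cH) /= lerDl sumr_ge0.
Qed.

(** On each side of [b] the distances to [b] are distinct integers between 1 and [H], so each side
    costs at most [2 * H]. *)
Let sum_d_dist b H : (1 <= b <= H)%N ->
  \sum_(1 <= a < H.+1 | a != b) d (dist a b) ^+ r <= 4 * H%:R.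
Proof.
move=> /andP[b1 bH].
rewrite (big_cat_nat b1) /=; last exact: leqW.
rewrite [X in _ + X]big_ltn_cond // eqxx /=.
rewrite (_ : 4 * H%:R = 2 * H%:R + 2 * H%:R :> R); last by ring.
apply: lerD.
  apply: le_trans (sum_d_mono H b (leqW bH)).
  rewrite [leRHS]big_nat_rev big_nat_cond [leRHS]big_nat_cond /=.
  rewrite le_eqVlt; apply/orP; left; apply/eqP; apply: eq_big => a.
    by apply: andb_id2l => /andP[_ ab]; rewrite ltn_eqF.
  move=> /andP[/andP[_ ab] _]; congr (d _ ^+ _).
  by rewrite /dist add1n subSS (eqP (ltnW ab)) add0n.
apply: le_trans (sum_d_mono H (H.+1 - b) (leq_subr _ _)).
rewrite -[b.+1]add1n big_addn.
rewrite le_eqVlt; apply/orP; left; apply/eqP.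
rewrite big_nat_cond [RHS]big_nat_cond; apply: eq_big => a.
  case: a => [|a]; first by [].
  by rewrite (_ : (a.+1 + b != b)%N = true) //; apply/eqP; lia.
by move=> _; congr (d _ ^+ _); rewrite /dist addnK; lia.
Qed.

(** A prime dividing several differences is counted several times on the right, harmlessly since all
    factors are at least 1. *)
Let prod_nonfresh_le a s :
  \prod_(i | has (fun b => a == b %[mod p i]) s) (q i)^-1
    <= \prod_(b <- s) d (dist a b).
Proof.
have qV i : 1 <= (q i)^-1 by rewrite -[leLHS]invr1 lef_pV2 ?posrE // q_gt0.
under [leRHS]eq_bigr do rewrite /d big_mkcond.
rewrite exchange_big big_mkcond /=; apply: ler_prod => i _.
have ge1 t : 1 <= \prod_(b <- t) (if (p i %| dist a b)%N then (q i)^-1 else 1).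
  apply: (big_ind (fun x => 1 <= x)) => // [x y x1 y1|b _].
    by rewrite mulr_ege1.
  by case: ifP.
case: ifP => [/hasP[b bs ab]|_]; last by rewrite ler01 ge1.
rewrite (le_trans _ (qV i)) // (big_rem b) //= -eqn_mod_distn ab.
by rewrite ler_peMr // (le_trans _ (qV i)).
Qed.

Let fresh_weight (a : nat) (s : seq nat) : R :=
  \prod_i (if has (fun b => a == b %[mod p i]) s then 1 else q i).

Let tuple_weight_cons a s :
  tuple_weight (a :: s) = tuple_weight s * fresh_weight a s.
Proof.
rewrite /tuple_weight -big_split /=; apply: eq_bigr => i _.
by rewrite nhit_cons exprD; case: has; rewrite ?expr0 ?expr1.
Qed.

(** A repeated value gets the trivial bound 1. Otherwise, taking out [V] leaves inverse factors at
    the primes dividing some difference, and the padded AM-GM inequality turns the product of the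
    [d (dist a b)] into a sum, so that each [b] can be averaged separately. *)
Let fresh_weight_le a s : (size s <= r)%N ->
  fresh_weight a s <= (a \in s)%:R + V / r%:R *
    (\sum_(b <- s | a != b) d (dist a b) ^+ r + (r - size s)%:R).
Proof.
move=> sr.
have d0 m : 0 <= d m by rewrite (le_trans _ (d_ge1 m)).
have rest0 : 0 <= V / r%:R * (\sum_(b <- s | a != b) d (dist a b) ^+ r + (r - size s)%:R).
  rewrite mulr_ge0 ?divr_ge0 // addr_ge0 // sumr_ge0 // => b _.
  by rewrite exprn_ge0.
case: (boolP (a \in s)) => [_|aNs].
  apply: le_trans (_ : 1 <= _); last by rewrite lerDl.
  apply: prodr_ile1 => i _; case: ifP => _; rewrite ?ler01 ?lexx //.
  by rewrite q_le1 ltW // q_gt0.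
rewrite add0r.
have -> : fresh_weight a s =
    V * \prod_(i | has (fun b => a == b %[mod p i]) s) (q i)^-1.
  rewrite [X in V * X]big_mkcond -big_split /=; apply: eq_bigr => i _.
  by case: ifP => _; rewrite ?mulr1 // divff // gt_eqF // q_gt0.
rewrite -mulrA ler_wpM2l // ler_pdivlMl ?ltr0n //.
apply: le_trans (ler_wpM2l (ler0n _ _) (prod_nonfresh_le a s)) _.
have := AGM_prod_le_pad _ r (map (fun b => d (dist a b)) s).
rewrite size_map !big_map => /(_ sr) H; apply: le_trans (H _) _.
  by apply/allP => _ /mapP[b _ ->].
rewrite lerD2r le_eqVlt; apply/orP; left; apply/eqP.
rewrite big_seq [RHS]big_seq_cond; apply: eq_bigl => b.
by case: (boolP (b \in s)) => //= bs; apply/esym; apply: contraNneq aNs => ->.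
Qed.

Lemma sum_tuple_weight_cons s H :
  (size s <= r)%N -> all (fun b => 1 <= b <= H)%N s ->
  \sum_(1 <= a < H.+1) tuple_weight (a :: s)
    <= (r%:R + 4 * H%:R * \prod_i (1 - (p i)%:R^-1)) * tuple_weight s.
Proof.
move=> sr sH; under eq_big_nat do rewrite tuple_weight_cons.
rewrite -mulr_sumr mulrC ler_wpM2r ?tuple_weight_ge0 // -/V.
apply: le_trans (ler_sum _ (fun a _ => fresh_weight_le a s sr)) _.
rewrite big_split /= -mulr_sumr big_split /= sumr_const_nat subn1 /=.
(* At most [size s <= r] values of [a] repeat an entry. *)
apply: lerD.
  rewrite -natr_sum ler_nat; apply: leq_trans sr.
  rewrite -big_mkcond sum1_count -size_filter; apply: uniq_leq_size.
    by rewrite filter_uniq ?iota_uniq.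
  by move=> a; rewrite mem_filter => /andP[].
have r0 : 0 < r%:R :> R by rewrite ltr0n.
rewrite mulrAC [leRHS]mulrC -mulrA ler_wpM2l // ler_pdivrMr //.
have sum1 : \sum_(1 <= a < H.+1) \sum_(b <- s | a != b) d (dist a b) ^+ r
    <= (size s)%:R * (4 * H%:R).
  under eq_bigr do rewrite big_mkcond.
  rewrite exchange_big /= mulr_natl.
  apply: le_trans (_ : \sum_(b <- s) 4 * H%:R <= _).
    rewrite big_seq [leRHS]big_seq; apply: ler_sum => b bs.
    by rewrite -big_mkcond sum_d_dist //; exact: (allP sH).
  by rewrite big_const_seq count_predT iter_addr_0.
have sr' : (size s)%:R <= r%:R :> R by rewrite ler_nat.
have H0 : 0 <= H%:R :> R by [].
rewrite natrB // -[_ *+ H]mulr_natl.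
have := ler_wpM2r H0 sr'; lra.
Qed.

(** * From prime tuples to moments *)

Variables (k : I -> nat) (M z : nat).
Hypothesis p_le_pow : forall i, (p i <= 2 ^ k i)%N.
Hypothesis p_le_z : forall i, (p i <= z)%N.
Hypothesis M_gt0 : (0 < M)%N.
Hypothesis mean_k : 2 * r%:R * \sum_i (k i)%:R / (p i)%:R <= M%:R :> R.

(** For [n > z] every [n + a] exceeds all the sieving primes, so if prime it is divisible by none of
    them; the [n <= z] cost [z.+1]. *)
Lemma prime_tuple_count (s : seq nat) (N : nat) : (0 < size s <= r)%N ->
  (\sum_(0 <= n < N) all (fun a => prime (n + a)) s)%:R
    <= 2 * N%:R * tuple_weight s + ((2 ^ (4 * M))%:R + z.+1%:R).
Proof.
move=> /andP[s0 sr].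
have nle i : (2 * nhit s i <= p i)%N.
  have := nhit_le s i; have := p_large i; lia.
(* As [nhit] is at most [r], one level [M] serves all the tuples. *)
have mean : 2 * \sum_i (k i)%:R * ((nbad I p (hit s) i)%:R / (p i)%:R) <= M%:R :> R.
  apply: le_trans mean_k; rewrite -mulrA ler_wpM2l // mulr_sumr.
  apply: ler_sum => i _; rewrite mulrCA ler_wpM2r ?divr_ge0 // ler_nat.
  exact: leq_trans (nhit_le s i) sr.
have := sieve_upper_bound R I p (hit s) k M coprime_primes (hit_mod s)
  (fun i => nhit_gt0 s i s0) nle p_le_pow M_gt0 mean N.
set S := (\sum_(0 <= n < N) [forall i, ~~ hit s i n])%N => SN.
have cS : (\sum_(0 <= n < N) all (fun a => prime (n + a)) s <= z.+1 + S)%N.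
  apply: leq_trans (_ : \sum_(0 <= n < N) ((n < z.+1) + [forall i, ~~ hit s i n]) <= _)%N.
    apply: leq_sum => n _; case: (ltnP n z.+1) => [_|zn]; first by case: all.
    case: (boolP (all _ s)) => //= /allP ps; rewrite add0n lt0b.
    apply/forallP => i; apply/hasPn => a /ps pa.
    rewrite dvdn_prime2 //; apply/eqP => e.
    by have := p_le_z i; rewrite e; lia.
  rewrite big_split leq_add2r /=.
  rewrite -big_mkcond sum1_count -size_filter -[leqRHS](size_iota 0).
  apply: uniq_leq_size; first by rewrite filter_uniq ?iota_uniq.
  by move=> a; rewrite mem_filter => /andP[az _]; rewrite mem_iota.
rewrite -(ler_nat R) natrD in cS.
have : \prod_i (1 - (nbad I p (hit s) i)%:R / (p i)%:R) <= tuple_weight s.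
  apply: ler_prod => i _; rewrite -/(nhit s i) subr_ge0 ler_pdivrMr ?ltr0n //.
  rewrite mul1r ler_nat (leq_trans _ (nle i)) ?leq_pmull //=.
  by apply: bernoulli_le; case/andP: (pV i) => /ltW -> ->.
have N0 : 0 <= 2 * N%:R :> R by rewrite mulr_ge0.
move=> /(ler_wpM2l N0); move: SN cS; set x := _%:R; lra.
Qed.

Theorem prime_moment_bound (N H : nat) :
  \sum_(0 <= n < N) (\sum_(1 <= a < H.+1) prime (n + a))%N%:R ^+ r
    <= 2 * N%:R * (r%:R + 4 * H%:R * \prod_i (1 - (p i)%:R^-1)) ^+ r
       + ((2 ^ (4 * M))%:R + z.+1%:R) * H%:R ^+ r :> R.
Proof.
set Gam := r%:R + _; set Err := (2 ^ (4 * M))%:R + z.+1%:R.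
have Gam0 : 0 <= Gam by rewrite addr_ge0 // mulr_ge0 // mulr_ge0.
have Err0 : 0 <= Err :> R by rewrite addr_ge0.
pose W n : R := (\sum_(1 <= a < H.+1) prime (n + a))%N%:R.
(* [s] holds the shifts already chosen and [j] counts the factors [W n] still to be expanded. Each
   expansion multiplies the main term by at most [Gam] and the error by [H]; the sieve is applied
   once [s] has length [r]. *)
suff step j s : (size s + j)%N = r -> all (fun b => 1 <= b <= H)%N s ->
    \sum_(0 <= n < N) (all (fun a => prime (n + a)) s)%:R * W n ^+ j
      <= 2 * N%:R * tuple_weight s * Gam ^+ j + Err * H%:R ^+ j.
  have := step r [::] (add0n _) isT.
  rewrite /tuple_weight (eq_bigr (fun=> 1)); last first.
    by move=> i _; rewrite nhit_nil expr0.
  rewrite big1_eq mulr1; apply: le_trans; apply: ler_sum => n _.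
  by rewrite mul1r.
elim: j s => [|j IH] s sj sH.
  rewrite !expr0 !mulr1; under eq_bigr do rewrite mulr1.
  rewrite -natr_sum; apply: prime_tuple_count.
  by rewrite -sj addn0 leqnn -(addn0 (size s)) sj r_gt0.
have -> : \sum_(0 <= n < N) (all (fun a => prime (n + a)) s)%:R * W n ^+ j.+1 =
    \sum_(1 <= a < H.+1) \sum_(0 <= n < N)
      (all (fun b => prime (n + b)) (a :: s))%:R * W n ^+ j.
  rewrite exchange_big /=; apply: eq_bigr => n _.
  rewrite exprS mulrA -mulr_suml; congr (_ * _).
  rewrite /W natr_sum mulr_sumr; apply: eq_bigr => a _.
  by rewrite -natrM mulnb andbC.
apply: le_trans (_ : \sum_(1 <= a < H.+1)
    (2 * N%:R * tuple_weight (a :: s) * Gam ^+ j + Err * H%:R ^+ j) <= _).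
  apply: ler_sum_nat => a aH; apply: IH; first by rewrite -sj addnS.
  by rewrite /= aH.
rewrite big_split /= sumr_const_nat subn1 /= lerD //; last first.
  by rewrite exprS mulrCA mulr_natl.
rewrite -mulr_suml -mulr_sumr exprS [leRHS]mulrA ler_wpM2r ?exprn_ge0 //.
rewrite -[leRHS]mulrA ler_wpM2l ?mulr_ge0 // [leRHS]mulrC.
apply: sum_tuple_weight_cons => //.
by rewrite -sj leq_addr.
Qed.

End Tuples.

(** * Elementary prime estimates *)

(** Telescoping, from [(t + 1) ^- 2 <= t^-1 - (t + 1)^-1]. *)
Lemma sum_invsq_le (R : realFieldType) (m N : nat) : (0 < m)%N ->
  \sum_(m.+1 <= n < N) (n%:R ^- 2) <= m%:R^-1 :> R.
Proof.
move=> m0; case: (leqP N m.+1) => [Nm|mN].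
  by rewrite big_geq // invr_ge0.
have mR : 0 < m%:R :> R by rewrite ltr0n.
suff H j : \sum_(m.+1 <= n < m.+1 + j) (n%:R ^- 2) <= m%:R^-1 - (m + j)%:R^-1 :> R.
  by rewrite -(subnKC (ltnW mN)) (le_trans (H _)) // gerBl invr_ge0.
elim: j => [|j IH]; first by rewrite !addn0 big_geq // subrr.
rewrite !addnS big_nat_recr ?ltnS ?leq_addr //=.
have t0 : 0 < (m + j)%:R :> R by rewrite ltr0n addn_gt0 m0.
rewrite addSn -natr1; move: (_ + _)%:R t0 IH => t t0 IH.
suff : (t + 1) ^- 2 <= t^-1 - (t + 1)^-1 by lra.
have -> : t^-1 - (t + 1)^-1 = (t * (t + 1))^-1 by field; rewrite !gt_eqF //; lra.
rewrite lef_pV2 ?posrE ?exprn_gt0 ?mulr_gt0 //; try lra; nra.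
Qed.

(** The substitution [n = p * m]; letting [m] run up to [N] instead of [N / p] avoids a floor and
    only adds nonnegative terms. *)
Lemma sum_dvd_reindex_le (R : realFieldType) (p N : nat) (Q : pred nat)
    (f : nat -> R) : (0 < p)%N -> (forall n, 0 <= f n) ->
  \sum_(1 <= n < N.+1 | (p %| n)%N && Q n) f n
    <= \sum_(1 <= m < N.+1 | Q (p * m)%N) f (p * m)%N.
Proof.
move=> p0 f0; rewrite [leLHS]big_mkcond [leRHS]big_mkcond /=.
apply: le_trans (_ : \sum_(1 <= n < N.+1) \sum_(1 <= m < N.+1)
   (n == p * m)%N%:R * (if Q (p * m)%N then f (p * m)%N else 0) <= _).
  have g0 n m : 0 <= (n == p * m)%N%:R * (if Q (p * m)%N then f (p * m)%N else 0).
    by rewrite mulr_ge0 //; case: ifP.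
  apply: ler_sum_nat => n /andP[n1 nN]; case: ifP => [/andP[pn Qn]|_].
    have [m e] := dvdnP pn; rewrite mulnC in e.
    rewrite (bigD1_seq m) ?iota_uniq //= -?e.
      by rewrite eqxx Qn mul1r lerDl sumr_ge0.
    rewrite mem_index_iota; apply/andP; split.
      by rewrite lt0n; apply: contraTneq n1 => m0; rewrite e m0 muln0.
    by rewrite (leq_ltn_trans _ nN) // e leq_pmull.
  by apply: sumr_ge0.
rewrite exchange_big /=; apply: ler_sum_nat => m _.
rewrite -mulr_suml -natr_sum ler_piMl //; first by case: ifP.
rewrite lern1 -big_mkcond sum1_count.
by rewrite (count_uniq_mem _ (iota_uniq _ _)) leq_b1.
Qed.

(* Euler's product: the terms divisible by the prime [p] peeled off by the
   induction are the [p * m] with [m] smooth for [p :: s]. *)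
Lemma sum_smooth_le (R : realFieldType) (s : seq nat) (N : nat) :
  all prime s ->
  (\sum_(1 <= n < N.+1 | all (mem s) (primes n)) n%:R^-1)
    * \prod_(p <- s) (1 - p%:R^-1) <= 1 :> R.
Proof.
elim: s => [|p s IH] /=.
  move=> _; rewrite big_nil mulr1 big_mkcond /=.
  case: N => [|N]; first by rewrite big_geq.
  rewrite big_nat_recl //= big_nat big1 ?addr0 ?invr1 // => -[|n] // _.
  case: ifP => //; case E: (primes n.+2) => [|q t] //.
  have := pdiv_prime (isT : 1 < n.+2)%N; have := pdiv_dvd n.+2 => d pr.
  by have := mem_primes (pdiv n.+2) n.+2; rewrite d pr E.
move=> /andP[pp /IH {}IH]; rewrite big_cons.
set T := \sum_(1 <= n < N.+1 | _) _.
have p0 : 0 < p%:R :> R by rewrite ltr0n prime_gt0.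
suff H : T * (1 - p%:R^-1) <= \sum_(1 <= n < N.+1 | all (mem s) (primes n)) n%:R^-1.
  rewrite mulrA; apply: le_trans IH; rewrite ler_wpM2r //.
  apply: prodr_ge0 => q _; rewrite subr_ge0.
  by case: q => [|q]; rewrite ?invr0 ?ler01 // invf_le1 ?ler1n ?ltr0n.
rewrite mulrBr mulr1 lerBlDr {1}/T.
rewrite (bigID (fun n => all (mem s) (primes n))) /=; apply: lerD.
  rewrite [leLHS]big_mkcond [leRHS]big_mkcond /=; apply: ler_sum_nat => n _.
  by case: ifP => [/andP[_ ->]|_] //; case: ifP => // _; rewrite invr_ge0.
apply: le_trans (_ : \sum_(1 <= n < N.+1 |
    (p %| n)%N && all (mem (p :: s)) (primes n)) n%:R^-1 <= _).
  rewrite [leLHS]big_mkcond [leRHS]big_mkcond /=; apply: ler_sum_nat => n /andP[n1 _].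
  case: ifP => [/andP[n_ps n_s]|_]; last by case: ifP => // _; rewrite invr_ge0.
  rewrite n_ps andbT ifT //; apply: contraNT n_s => pn.
  apply/allP => q qn; have := allP n_ps q qn; rewrite !inE => /predU1P[e|//].
  by move: pn; rewrite -e; move: qn; rewrite mem_primes => /and3P[_ _ ->].
apply: le_trans (sum_dvd_reindex_le _ _ _ _ _ (prime_gt0 pp) _) _.
  by move=> n; rewrite invr_ge0.
rewrite /T mulr_suml big_mkcond [leRHS]big_mkcond /=; apply: ler_sum_nat => m /andP[m1 _].
rewrite natrM invfM mulrC; case: ifP => [H|_]; last first.
  by case: ifP => // _; rewrite mulr_ge0 ?invr_ge0.
rewrite ifT //; apply/allP => q; rewrite mem_primes => /and3P[qp _ qm].
apply: (allP H); rewrite mem_primes qp muln_gt0 m1 prime_gt0 //=.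
exact: dvdn_mull.
Qed.

(** The block after [2 ^ K] has [2 ^ K] terms, none below [1 / 2 ^ K.+1]. *)
Lemma harmonic_pow2_ge (R : realFieldType) (K : nat) :
  K%:R / 2 <= \sum_(1 <= n < (2 ^ K).+1) n%:R^-1 :> R.
Proof.
elim: K => [|K IH]; first by rewrite mul0r sumr_ge0 // => n _; rewrite invr_ge0.
have le : ((2 ^ K).+1 <= (2 ^ K.+1).+1)%N by rewrite ltnS leq_exp2l.
rewrite (big_cat_nat _ le) //= -natr1 mulrDl lerD //.
apply: le_trans (_ : \sum_((2 ^ K).+1 <= n < (2 ^ K.+1).+1) (2 ^ K.+1)%:R^-1 <= _).
  rewrite sumr_const_nat subSS expnS mul2n -addnn addnK -[leRHS]mulr_natr natrD.
  have : 0 < (2 ^ K)%:R :> R by rewrite ltr0n expn_gt0.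
  move: (2 ^ K)%:R => t t0; rewrite [leRHS](_ : _ = 1 / 2) //.
  by field; rewrite ?gt_eqF //; lra.
apply: ler_sum_nat => n /andP[n1 n2]; rewrite lef_pV2 ?posrE ?ltr0n ?expn_gt0 //.
  by rewrite ler_nat.
exact: leq_ltn_trans n1.
Qed.

Definition sieving_primes (c z : nat) : seq nat :=
  [seq n <- iota 0 z.+1 | prime n && (c < n)%N].

(** Enlarging the primes up to [c] to all integers from 2 to [c] gives a telescoping product; [minn]
    records how far it has run. *)
Lemma prod_small_primes_ge (R : realFieldType) (c N : nat) : (0 < c)%N ->
  (minn N.+1 c)%:R^-1 <=
  \prod_(0 <= n < N.+2 | prime n && ~~ (c < n)%N) (1 - n%:R^-1) :> R.
Proof.
move=> c0; elim: N => [|N IH].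
  by rewrite big_mkcond !big_nat_recl //= big_geq // !mulr1 (minn_idPl c0) invr1.
rewrite big_mkcond big_nat_recr //= -big_mkcond /=.
have m0 n : 0 < (minn n.+1 c)%:R :> R by rewrite ltr0n leq_min.
case: ifP => [/andP[_ Nc]|_]; last first.
  rewrite mulr1 (le_trans _ IH) // lef_pV2 ?posrE // ler_nat.
  by rewrite leq_min geq_minr geq_min leqnSn.
rewrite -leqNgt in Nc; rewrite (minn_idPl Nc); rewrite (minn_idPl (ltnW Nc)) in IH.
apply: le_trans (ler_wpM2r _ IH).
  rewrite mulrBr mulr1 -[N.+2]addn1 natrD.
  have : 0 < N.+1%:R :> R by rewrite ltr0n.
  move: N.+1%:R => t t0; rewrite le_eqVlt; apply/orP; left; apply/eqP.
  by field; rewrite !gt_eqF //; lra.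
by rewrite subr_ge0 invf_le1 ?ler1n ?ltr0n.
Qed.

(** The harmonic sum up to [2 ^ K] is at least [K / 2] and at most Euler's product over the primes
    up to [2 ^ K], in which the primes up to [c] account for a factor at most [c]. *)
Lemma sieving_primes_prod_le (R : realFieldType) (c K : nat) :
  (0 < c)%N -> (0 < K)%N ->
  \prod_(n <- sieving_primes c (2 ^ K)) (1 - n%:R^-1) <= 2 * c%:R / K%:R :> R.
Proof.
move=> c0 K0; set V := \prod_(n <- _) _.
have cR : 0 < c%:R :> R by rewrite ltr0n.
have KR : 0 < K%:R :> R by rewrite ltr0n.
have f0 n : 0 <= 1 - n%:R^-1 :> R.
  (* At [n = 0] the inverse is 0 by convention and the factor is 1. *)
  by rewrite subr_ge0; case: n => [|n]; rewrite ?invr0 ?ler01 // invf_le1 ?ler1n ?ltr0n.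
have V0 : 0 <= V by apply: prodr_ge0.
set Sm := \prod_(0 <= n < (2 ^ K).+1 | prime n && ~~ (c < n)%N) (1 - n%:R^-1) : R.
have SmG : c%:R^-1 <= Sm.
  have zE : (2 ^ K).+1 = (2 ^ K).-1.+2 by rewrite prednK ?expn_gt0.
  rewrite /Sm zE; apply: le_trans (prod_small_primes_ge _ c _ c0).
  by rewrite lef_pV2 ?posrE ?ltr0n ?leq_min ?c0 // ler_nat geq_minr.
set ps := [seq n <- iota 0 (2 ^ K).+1 | prime n].
have psP q : prime q -> (q <= 2 ^ K)%N -> q \in ps.
  by move=> qp qK; rewrite mem_filter qp mem_iota.
have := sum_smooth_le R ps (2 ^ K) (filter_all _ _).
have -> : \prod_(p <- ps) (1 - p%:R^-1) = V * Sm :> R.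
  rewrite big_filter (bigID (fun n => c < n)%N) /V big_filter.
  by rewrite /Sm /index_iota subn0.
have -> : \sum_(1 <= n < (2 ^ K).+1 | all (mem ps) (primes n)) n%:R^-1
   = \sum_(1 <= n < (2 ^ K).+1) n%:R^-1 :> R.
  rewrite big_nat_cond [RHS]big_nat_cond; apply: eq_bigl => n.
  rewrite andbT; case: (boolP (_ <= _ < _)%N) => //= /andP[n1 nz].
  apply/allP => q; rewrite mem_primes => /and3P[qp _ qn].
  by rewrite inE psP // (leq_trans (dvdn_leq n1 qn)).
move=> H.
have H2 : K%:R / 2 * (V * c%:R^-1) <= 1.
  apply: le_trans H; apply: ler_pM; rewrite ?divr_ge0 ?mulr_ge0 ?invr_ge0 //.
    exact: harmonic_pow2_ge.
  by rewrite ler_wpM2l.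
rewrite ler_pdivlMr // -(ler_pM2r (_ : 0 < (2 * c%:R)^-1)) ?invr_gt0 ?mulr_gt0 //.
rewrite divff ?mulf_neq0 ?gt_eqF // invfM; apply: le_trans H2.
by rewrite le_eqVlt; apply/orP; left; apply/eqP; ring.
Qed.

(** * Chebyshev's bound and a Mertens sum *)

Lemma prime_ndvd_fact (p n : nat) : prime p -> (n < p)%N -> ~~ (p %| n`!)%N.
Proof.
move=> pp; elim: n => [|n IH] np; first by rewrite dvdn1 neq_ltn prime_gt1 ?orbT.
by rewrite factS Euclid_dvdM // negb_or IH ?gtnNdvd // ltnW.
Qed.

Lemma bin_le_pow2 (n m : nat) : ('C(n, m) <= 2 ^ n)%N.
Proof.
case: (leqP m n) => [mn|nm]; last by rewrite bin_small.
rewrite -[X in (_ <= X ^ _)%N]/(1 + 1)%N expnDn (bigD1 (Ordinal (mn : m < n.+1)%N)) //=.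
by rewrite !exp1n !muln1 leq_addr.
Qed.

(** The primes counted exceed [2 ^ j] and all divide the central binomial coefficient of [2 ^ j.+1],
    which is at most [2 ^ (2 ^ j.+1)]; exponents of 2 are then compared. *)
Lemma chebyshev_dyadic (j : nat) :
  (j * \sum_((2 ^ j).+1 <= n < (2 ^ j.+1).+1) prime n <= 2 ^ j.+1)%N.
Proof.
set s := [seq n <- index_iota (2 ^ j).+1 (2 ^ j.+1).+1 | prime n].
have -> : (\sum_((2 ^ j).+1 <= n < (2 ^ j.+1).+1) prime n = size s)%N.
  by rewrite -big_mkcond sum1_count size_filter.
have sP n : n \in s -> [&& prime n, 2 ^ j < n & n <= 2 ^ j.+1]%N.
  by rewrite mem_filter mem_index_iota ltnS.
rewrite -(leq_exp2l _ _ (isT : 1 < 2)%N); apply: leq_trans (bin_le_pow2 _ (2 ^ j)).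
have us : uniq s by rewrite filter_uniq ?iota_uniq.
apply: leq_trans (_ : \prod_(n <- s) n <= _)%N.
  rewrite expnM -count_predT -iter_muln_1 -big_const_seq.
  by rewrite big_seq [leqRHS]big_seq; apply: leq_prod => n /sP /and3P[_ /ltnW].
apply: dvdn_leq; first by rewrite bin_gt0 leq_exp2l.
apply: dvdn_prod_coprime => // [m n /sP/and3P[pm _ _] /sP/and3P[pn _ _] mn|].
  by rewrite prime_coprime // dvdn_prime2.
move=> n /sP /and3P[pn n1 n2].
have : (n %| (2 ^ j.+1)`!)%N by rewrite dvdn_fact // prime_gt0.
rewrite -(bin_fact (leq_pexp2l (isT : 0 < 2)%N (leqnSn j))).
have -> : (2 ^ j.+1 - 2 ^ j = 2 ^ j)%N by rewrite expnS mul2n -addnn addnK.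
by rewrite !Euclid_dvdM // orbb (negbTE (prime_ndvd_fact _ _ pn n1)) orbF.
Qed.

(** A Mertens-type bound, by dyadic blocks: the one ending at [2 ^ K.+2] has at most
    [2 ^ K.+2 / K.+1] primes, each contributing at most [K.+2 / 2 ^ K.+1], hence at most 4 in
    all. *)
Lemma sum_up_log_div_le (R : realFieldType) (c K : nat) : (1 < c)%N ->
  \sum_(n <- sieving_primes c (2 ^ K)) (up_log 2 n)%:R / n%:R <= 4 * K%:R :> R.
Proof.
move=> c1.
(* [c > 1] excludes the prime 2, on whose block [j = 0] Chebyshev's bound says nothing. *)
apply: le_trans (_ : \sum_(3 <= n < (2 ^ K).+1 | prime n) (up_log 2 n)%:R / n%:R <= _).
  rewrite big_filter.
  have -> : iota 0 (2 ^ K).+1 = index_iota 0 (2 ^ K).+1 by rewrite /index_iota subn0.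
  have f0 n : 0 <= (up_log 2 n)%:R / n%:R :> R by rewrite divr_ge0.
  case: (ltnP (2 ^ K) 3) => [K3|K3].
    rewrite [leRHS]big_geq // big_nat_cond big_pred0 // => n.
    by apply/negbTE; lia.
  rewrite (big_cat_nat (n := 3)) ?(leqW K3) //= big_nat_cond big_pred0 ?add0r; last first.
    by move=> n; apply/negbTE; lia.
  rewrite [leLHS]big_mkcond [leRHS]big_mkcond; apply: ler_sum => n _.
  by case: prime => //=; case: ifP.
elim: K => [|[|K] IH]; first by rewrite big_geq ?mulr_ge0.
  by rewrite big_geq ?mulr_ge0.
have le : ((2 ^ K.+1).+1 <= (2 ^ K.+2).+1)%N by rewrite ltnS leq_exp2l.
have two : (3 <= (2 ^ K.+1).+1)%N by rewrite ltnS -[X in (X <= _)%N](expn1 2) leq_exp2l.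
rewrite (big_cat_nat two le) /=.
rewrite -[K.+2%:R]natr1 mulrDr mulr1 lerD //.
have t0 : 0 < (2 ^ K.+1)%:R :> R by rewrite ltr0n expn_gt0.
apply: le_trans (_ : \sum_((2 ^ K.+1).+1 <= n < (2 ^ K.+2).+1)
    (prime n)%:R * (K.+2%:R / (2 ^ K.+1)%:R) <= _).
  rewrite [leLHS]big_mkcond /=; apply: ler_sum_nat => n /andP[n1 n2].
  case: prime; rewrite ?mul0r // mul1r; apply: ler_pM; rewrite ?invr_ge0 //.
    by rewrite ler_nat up_log_min.
  rewrite lef_pV2 ?posrE ?ltr0n ?expn_gt0 ?ler_nat ?(ltnW n1) //.
  exact: leq_ltn_trans n1.
rewrite -mulr_suml -natr_sum mulrA ler_pdivrMr //.
have := chebyshev_dyadic K.+1; rewrite [leqRHS]expnS -(ler_nat R) !natrM.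
set S := (\sum_(_ <= n < _) _)%:R => H.
have K0 : 0 < K.+1%:R :> R by rewrite ltr0n.
have KK : K.+2%:R <= 2 * K.+1%:R :> R by rewrite -natrM ler_nat; lia.
have S0 : 0 <= S by [].
by have := ler_wpM2l S0 KK; lra.
Qed.

Lemma sum_sieving_invsq_le (R : realFieldType) (c z : nat) : (0 < c)%N ->
  \sum_(n <- sieving_primes c z) (n%:R ^- 2) <= c%:R^-1 :> R.
Proof.
move=> c0; apply: le_trans (sum_invsq_le R c (maxn c.+1 z.+1) c0).
have f0 n : 0 <= n%:R ^- 2 :> R by rewrite invr_ge0 exprn_ge0.
rewrite big_filter.
have -> : iota 0 z.+1 = index_iota 0 z.+1 by rewrite /index_iota subn0.
apply: le_trans
  (_ : \sum_(0 <= n < maxn c.+1 z.+1 | prime n && (c < n)%N) n%:R ^- 2 <= _).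
  rewrite [leRHS](big_cat_nat (n := z.+1)) ?leq_maxr //= lerDl.
  by apply: sumr_ge0.
rewrite (big_cat_nat (n := c.+1)) ?leq_maxl //= big_nat_cond big_pred0 ?add0r.
  by rewrite big_mkcond; apply: ler_sum => n _; case: ifP.
by move=> n; apply/negbTE; lia.
Qed.

(** * Moments *)

(** The sieving primes lie in [(4 * r, 2 ^ K]]. The mean condition requires [2 * r * (4 * K)],
    whence [M = 8 * r * K] and the exponent [32 * r * K]; the product over the primes is at most
    [8 * r / K], whence [32 * H * r / K]. *)
Theorem prime_interval_moment (R : realFieldType) (N H r K : nat) :
  (0 < r)%N -> (0 < K)%N ->
  \sum_(0 <= n < N) (\sum_(1 <= a < H.+1) prime (n + a))%N%:R ^+ r
    <= 2 * N%:R * (r%:R + 32 * H%:R * r%:R / K%:R) ^+ r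
       + ((2 ^ (32 * (r * K)))%:R + (2 ^ K).+1%:R) * H%:R ^+ r :> R.
Proof.
move=> r0 K0; set ps := sieving_primes (4 * r) (2 ^ K).
have c0 : (0 < 4 * r)%N by lia.
pose p (i : 'I_(size ps)) := nth 0%N ps i.
have pP i : [&& prime (p i), 4 * r < p i & p i <= 2 ^ K]%N.
  have : p i \in ps by rewrite mem_nth.
  by rewrite mem_filter mem_iota => /andP[/andP[-> ->]].
have p_inj : injective p.
  move=> i j /eqP; rewrite nth_uniq ?filter_uniq ?iota_uniq //.
  by move=> /eqP /val_inj.
have bigp (S : Type) (idx : S) (op : S -> S -> S) (F : nat -> S) :
    \big[op/idx]_i F (p i) = \big[op/idx]_(n <- ps) F n.
  by rewrite (big_nth 0%N) big_mkord.
have Q1 : (4 * r)%:R * \sum_i ((p i)%:R ^- 2) <= 1 :> R.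
  rewrite (bigp _ _ _ (fun n => n%:R ^- 2)).
  have := sum_sieving_invsq_le R (4 * r) (2 ^ K) c0.
  by rewrite -[_^-1]mul1r ler_pdivlMr ?ltr0n // mulrC.
have Q2 : 2 * r%:R * \sum_i (up_log 2 (p i))%:R / (p i)%:R <= (8 * (r * K))%:R :> R.
  rewrite (bigp _ _ _ (fun n => (up_log 2 n)%:R / n%:R)).
  have c1 : (1 < 4 * r)%N by lia.
  have := sum_up_log_div_le R (4 * r) K c1.
  have r2 : 0 <= 2 * r%:R :> R by rewrite mulr_ge0.
  by move=> /(ler_wpM2l r2) /le_trans; apply; rewrite !natrM; lra.
have p1 i : prime (p i) by have /and3P[] := pP i.
have p2 i : (4 * r < p i)%N by have /and3P[] := pP i.
have p3 i : (p i <= 2 ^ up_log 2 (p i))%N by exact: up_logP.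
have p4 i : (p i <= 2 ^ K)%N by have /and3P[] := pP i.
have M0 : (0 < 8 * (r * K))%N by rewrite !muln_gt0 r0 K0.
have := prime_moment_bound R _ p r p_inj p1 p2 r0 Q1
  (fun i => up_log 2 (p i)) _ _ p3 p4 M0 Q2 N H.
rewrite (bigp _ _ _ (fun n => 1 - n%:R^-1)) mulnA => /le_trans; apply.
rewrite lerD2r ler_wpM2l ?mulr_ge0 //.
have V := sieving_primes_prod_le R (4 * r) K c0 K0.
have V0 : 0 <= \prod_(n <- ps) (1 - n%:R^-1) :> R.
  apply: prodr_ge0 => q _; rewrite subr_ge0.
  by case: q => [|q]; rewrite ?invr0 ?ler01 // invf_le1 ?ler1n ?ltr0n.
apply: lerXn2r; rewrite ?nnegrE ?addr_ge0 ?mulr_ge0 ?invr_ge0 //.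
rewrite lerD2l; have H4 : 0 <= 4 * H%:R :> R by rewrite mulr_ge0.
have := ler_wpM2l H4 V => /le_trans; apply.
rewrite natrM le_eqVlt; apply/orP; left; apply/eqP.
by field; rewrite pnatr_eq0 -lt0n.
Qed.

(** As [n] is an integer, the floor of [n + h] is [n] plus the floor of [h]. *)
Lemma prime_pi_diff (R : realType) (n : nat) (h : R) : 0 <= h ->
  (prime_pi (n%:R + h))%:R - (prime_pi (n%:R : R))%:R
  = (\sum_(1 <= a < (Num.truncn h).+1) prime (n + a))%N%:R :> R.
Proof.
move=> h0; rewrite /prime_pi natrK.
have -> : Num.truncn (n%:R + h) = (n + Num.truncn h)%N.
  apply: truncn_def; rewrite natrD lerD2l.
  by have /andP[-> ht] := truncn_itv h0; rewrite -addnS natrD ltrD2l.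
rewrite -addSn iotaD count_cat natrD addrAC subrr add0r add0n; congr _%:R.
set H := Num.truncn h.
rewrite -sum1_count big_mkcond /=.
rewrite -[X in iota X]addn0 iotaDl big_map.
rewrite big_add1 /= /index_iota subn0; apply: eq_bigr => a _.
by rewrite addSnnS.
Qed.

(** From [expR (- 6^-1) >= 5 / 6] and [(5 / 6) ^+ 6 > 1 / 3]; it serves to show [ln 3 > 1]. *)
Lemma expR1_lt3 (R : realType) : expR 1 < 3 :> R.
Proof.
have e0 : 0 < expR (- 6^-1) :> R := expR_gt0 _.
have H : 5 / 6 <= expR (- 6^-1) :> R.
  by apply: le_trans (expR_ge1Dx _); lra.
have H6 : (5 / 6) ^+ 6 <= expR (-1) :> R.
  have -> : -1 = 6%:R * (- 6^-1) :> R by field.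
  by rewrite expRM_natl lerXn2r // nnegrE; lra.
have : expR (-1) * expR 1 = 1 :> R by rewrite -expRD addNr expR0.
by have := expR_gt0 (1 : R); nra.
Qed.

(** [t] stands for the cube root of [ln x]. In the constant 7, the main term accounts for 4 and the
    sieve error for 3. *)
Lemma prime_moment_le (R : realType) (c lam x t : R) (r : nat) :
  0 < c -> c <= lam -> 0 < x -> (0 < r)%N -> t ^+ 3 = ln x -> r%:R <= t ->
  12 <= t ->
  prime_moment r x (lam * ln x)
    <= 7 * (c^-1 + 4096) ^+ r * (lam ^+ r * r%:R ^+ (2 * r)).
Proof.
move=> c0 clam x0 r0 tx rt t12; set L := ln x.
have expR_ge1 y : 0 <= y -> 1 <= expR y by have := expR_ge1Dx y; lra.
have LE : L = t ^+ 3 by [].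
have rR : 1 <= r%:R :> R by rewrite ler1n.
have t0 : 0 < t by lra.
have tt : 144 <= t ^+ 2 by rewrite expr2; nra.
have L144 : 144 * r%:R <= L by rewrite LE exprS; nra.
have L0 : 0 < L by lra.
have r64 : 0 < 64 * r%:R :> R by lra.
have lam0 : 0 < lam by lra.
have x1 : 1 <= x by rewrite -[x]lnK ?posrE // expR_ge1 // ltW.
set h := lam * L.
have h0 : 0 <= h by rewrite mulr_ge0 // ltW.
(* This choice gives [32 * r * K <= L / 2], so that [2 ^ (32 * r * K)] is at most [expR (L / 2)],
   the square root of [x]. *)
pose K := Num.truncn (L / (64 * r%:R)).
pose H := Num.truncn h; pose N := Num.truncn x.
have q0 : 0 <= L / (64 * r%:R) by rewrite divr_ge0 ?ltW // mulr_gt0 //; lra.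
have /andP[Kle Klt] := truncn_itv q0; rewrite -/K in Kle Klt.
rewrite -[K.+1%:R]natr1 in Klt.
have q2 : 2 <= L / (64 * r%:R) by rewrite ler_pdivlMr //; lra.
have K1 : 1 <= K%:R :> R by rewrite ler1n truncn_ge_nat //; lra.
have K0 : (0 < K)%N by rewrite -(ltr_nat R); lra.
have Kle' : 64 * r%:R * K%:R <= L.
  by move: Kle; rewrite ler_pdivlMr //; lra.
(* Since [K >= 1], rounding down loses at most a factor 2. *)
have Kge : L <= 128 * r%:R * K%:R.
  have : L < (K%:R + 1) * (64 * r%:R) by rewrite -ltr_pdivrMr.
  have : 1 * r%:R <= K%:R * r%:R :> R by rewrite ler_wpM2r.
  by lra.
set s := expR (L / 2).
have s1 : 1 <= s by apply: expR_ge1; lra.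
have ss : s * s = x by rewrite -expRD -splitr lnK.
have two_e : 2 <= expR 1 :> R by have := expR_ge1Dx (1 : R); lra.
have pow_s m : m%:R <= L / 2 -> (2 ^ m)%:R <= s.
  move=> mL; rewrite natrX; apply: le_trans (_ : expR 1 ^+ m <= _).
    by rewrite lerXn2r ?nnegrE // ltW // expR_gt0.
  by rewrite -expRM_natl mulr1 ler_expR.
(* The cube root matters here: [L ^+ r = t ^+ (3 * r) <= expR (3 * r * t)], and
   [3 * r * t <= 3 * t ^+ 2 <= t ^+ 3 / 2]. *)
have Lr : L ^+ r <= s.
  have te : t <= expR t by have := expR_ge1Dx t; lra.
  rewrite LE -exprM; apply: le_trans (_ : expR t ^+ (3 * r) <= _).
    by rewrite lerXn2r ?nnegrE // ltW // expR_gt0.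
  rewrite -expRM_natl ler_expR natrM LE exprS.
  have : r%:R * t <= t * t by rewrite ler_wpM2r // ltW.
  by rewrite -expr2; nra.
have Hh : H%:R <= h by rewrite truncn_le.
have Nx : N%:R <= x by rewrite truncn_le ltW.
(* [c^-1] absorbs the term [r], since [1 <= c^-1 * lam]; [4096 = 32 * 128] comes from [H <= lam * L]
   and [L <= 128 * r * K]. *)
pose A := c^-1 + 4096.
have cV : 0 < c^-1 by rewrite invr_gt0.
have A0 : 0 <= A by rewrite /A; lra.
have sumE : \sum_(1 <= n < N.+1)
    ((prime_pi (n%:R + h))%:R - (prime_pi (n%:R : R))%:R) ^+ r
    <= 4 * x * (A * (lam * r%:R ^+ 2)) ^+ r + 3 * s * h ^+ r.
  under eq_bigr do rewrite prime_pi_diff //.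
  apply: le_trans (_ : \sum_(0 <= n < N.+1)
    (\sum_(1 <= a < H.+1) prime (n + a))%N%:R ^+ r <= _).
    by rewrite [leRHS]big_ltn // lerDr exprn_ge0.
  apply: le_trans (prime_interval_moment R N.+1 H r K r0 K0) _.
  apply: lerD.
    apply: ler_pM; rewrite ?mulr_ge0 ?exprn_ge0 ?addr_ge0 ?mulr_ge0 ?invr_ge0 //.
      by rewrite -natr1; lra.
    apply: lerXn2r; rewrite ?nnegrE ?addr_ge0 ?mulr_ge0 ?invr_ge0 ?exprn_ge0 //; try lra.
    rewrite [leRHS]mulrDl; apply: lerD.
      rewrite mulrA expr2 -[leLHS]mul1r ler_pM //; try lra; last by nra.
      by rewrite mulrC ler_pdivlMr // mul1r.
    rewrite ler_pdivrMr; last lra.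
    apply: le_trans (_ : 32 * (lam * (128 * r%:R * K%:R)) * r%:R <= _).
      rewrite ler_wpM2r // ler_wpM2l //; apply: le_trans Hh _.
      by rewrite ler_wpM2l // ltW.
    by rewrite le_eqVlt; apply/orP; left; apply/eqP; ring.
  have E1 : (2 ^ (32 * (r * K)))%:R <= s.
    by apply: pow_s; rewrite !natrM; lra.
  have E2 : (2 ^ K)%:R <= s.
    have rK : 1 * K%:R <= r%:R * K%:R :> R by rewrite ler_wpM2r.
    by apply: pow_s; clear -rK Kle' K1; lra.
  have E12 : (2 ^ (32 * (r * K)))%:R + (2 ^ K).+1%:R <= 3 * s.
    have -> : 3 * s = s + (s + s) by ring.
    by rewrite -[(2 ^ K).+1%:R]natr1 !lerD.
  apply: ler_pM E12 _; rewrite ?addr_ge0 ?exprn_ge0 //.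
  by rewrite lerXn2r ?nnegrE.
rewrite /prime_moment mulrC ler_pdivrMr //; apply: le_trans sumE _.
have P0 : 0 <= lam ^+ r * r%:R ^+ (2 * r) by rewrite mulr_ge0 ?exprn_ge0 ?ltW //; lra.
have A1 : 1 <= A ^+ r by rewrite exprn_ege1 // /A; lra.
have -> : 4 * x * (A * (lam * r%:R ^+ 2)) ^+ r
    = 4 * A ^+ r * (lam ^+ r * r%:R ^+ (2 * r)) * x.
  by rewrite [(A * _) ^+ r]exprMn [(lam * _) ^+ r]exprMn -exprM; ring.
apply: le_trans (_ : _ <= 4 * A ^+ r * (lam ^+ r * r%:R ^+ (2 * r)) * x
   + 3 * A ^+ r * (lam ^+ r * r%:R ^+ (2 * r)) * x) _; last first.
  by rewrite le_eqVlt; apply/orP; left; apply/eqP; rewrite -/A; ring.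
rewrite lerD2l /h exprMn.
have lr0 : 0 <= lam ^+ r by rewrite exprn_ge0 // ltW.
have lr : lam ^+ r <= A ^+ r * (lam ^+ r * r%:R ^+ (2 * r)).
  by rewrite mulrCA; apply: ler_peMr => //; rewrite mulr_ege1 // exprn_ege1.
have sx : s * L ^+ r <= x by rewrite -ss ler_wpM2l //; lra.
have sL : 0 <= s * L ^+ r by rewrite mulr_ge0 ?exprn_ge0 // ltW // expR_gt0.
have := ler_pM lr0 sL lr sx; clear; lra.
Qed.

(** For [r >= 2], [|ln (ln r)|] stays away from 0: it is positive at 2 and at least [ln (ln 3) > 0]
    beyond. At [r = 1] the exponential is 1, because [ln 0 = 0] by convention, and the factor [C] in
    front suffices. *)
Lemma expR_dominates_pow (R : realType) (C : R) : 1 <= C ->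
  exists2 A : R, 0 < A & forall r : nat, (0 < r)%N ->
    C ^+ r <= C * expR (A * (r%:R * `|ln (ln r%:R)|)).
Proof.
move=> C1; have C0 : 0 < C by lra.
have e3 := expR1_lt3 R.
have ln2 : (0 < ln 2 :> R) && (ln 2 < 1 :> R).
  rewrite ln_gt0 ?ltr1n //= -[X in _ < X](expRK (1 : R)) ltr_ln ?posrE ?expR_gt0 //.
  by have := expR_gt1Dx (oner_neq0 R).
have ln3 : 1 < ln 3 :> R.
  by rewrite -[X in X < _](expRK (1 : R)) ltr_ln ?posrE ?expR_gt0.
have l2 : 0 < `|ln (ln 2)| :> R by rewrite normr_gt0 ltr0_neq0 // ln_lt0.
have l3 : 0 < ln (ln 3) :> R by rewrite ln_gt0.
pose d : R := Num.min `|ln (ln 2)| (ln (ln 3)).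
have d0 : 0 < d by rewrite lt_min l2.
have dr (r : nat) : (1 < r)%N -> d <= `|ln (ln r%:R)|.
  case: r => [|[|[|r]]] // _; first by rewrite ge_min lexx.
  have l33 : ln 3 <= ln r.+3%:R :> R by rewrite ler_ln ?posrE // ler_nat.
  apply: le_trans (ler_norm _); rewrite /d ge_min ler_ln ?posrE ?l33 ?orbT //; lra.
have lC : 0 <= ln C by rewrite ln_ge0.
exists ((ln C + 1) / d); first by rewrite divr_gt0 //; lra.
move=> [|[|r]] // _.
  by rewrite expr1 ln1 (ln0 (lexx 0)) normr0 !mulr0 expR0 mulr1.
rewrite -[leLHS]mul1r; apply: ler_pM => //; first by rewrite exprn_ge0 // ltW.
rewrite -{1}[C]lnK ?posrE // -expRM_natl ler_expR.
rewrite mulrCA ler_wpM2l //; apply: le_trans (_ : (ln C + 1) / d * d <= _).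
  by rewrite divfK ?gt_eqF //; lra.
by rewrite ler_wpM2l ?dr // divr_ge0 ?ltW //; lra.
Qed.

(** * The asymptotic statement *)

Local Open Scope classical_set_scope.

Theorem theorem1p8 (R : realType) (lambda h : R -> R) (r : R -> nat) (c : R)
    (c_gt0 : 0 < c)
    (lambda_ge : \forall x \near +oo, c <= lambda x)
    (h_def : forall x : R, 0 < x -> h x = lambda x * ln x)
    (h_small : h =o_+oo (fun x : R => x))
    (r_gt0 : forall x : R, 0 < x -> (0 < r x)%N)
    (r_small : (fun x : R => (r x)%:R : R) =o_+oo
                 (fun x : R => (ln x) `^ (3%:R^-1) : R)) :
  exists2 E : R -> R,
    E =O_+oo (fun x : R => (r x)%:R * ln (ln ((r x)%:R : R)) : R) &
    (fun x : R => prime_moment (r x) x (h x)) =O_+oo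
      (fun x : R => lambda x ^+ r x * (r x)%:R ^+ (2 * r x) * expR (E x) : R).
Proof.
pose C : R := c^-1 + 4096.
have cV : 0 < c^-1 by rewrite invr_gt0.
have C1 : 1 <= C by rewrite /C; lra.
have [A A0 HA] := expR_dominates_pow R C C1.
(* The absolute value matters at [r x = 2], where [ln (ln 2)] is negative. *)
exists (fun x => A * ((r x)%:R * `|ln (ln (r x)%:R)|)).
  apply/eqO_exP; exists A => //; apply: filterE => x.
  by rewrite !normrM normr_id (gtr0_norm A0).
apply/eqO_exP; exists (7 * C); first by rewrite mulr_gt0 //; lra.
(* With constant 1, the little-o says that [r x] is eventually at most the cube root of [ln x]. *)
have /eqoP/(_ 1 ltr01) r_le := r_small.
near=> x.
have x_ge : expR (12 ^+ 3) <= x by near: x; apply: nbhs_pinfty_ge; exact: num_real.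
have x0 : 0 < x by apply: lt_le_trans x_ge; exact: expR_gt0.
have Lx : 12 ^+ 3 <= ln x by rewrite -(expRK (12 ^+ 3 : R)) ler_ln ?posrE ?expR_gt0.
have Lx0 : 0 <= ln x by apply: le_trans Lx; exact: exprn_ge0.
have cl : c <= lambda x by near: x.
have l0 : 0 < lambda x by apply: lt_le_trans cl.
have rt : (r x)%:R <= ln x `^ 3^-1.
  have : `|(r x)%:R : R| <= 1 * `|ln x `^ 3^-1| by near: x.
  by rewrite mul1r ger0_norm // ger0_norm ?powR_ge0.
have t3 : (ln x `^ 3^-1) ^+ 3 = ln x.
  by rewrite -powR_mulrn ?powR_ge0 // -powRrM mulVf // powRr1.
have t12 : 12 <= ln x `^ 3^-1.
  by rewrite -(ler_pXn2r (n := 3)) ?nnegrE ?powR_ge0 // t3.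
have := prime_moment_le R c (lambda x) x (ln x `^ 3^-1) (r x) c_gt0 cl x0
  (r_gt0 x x0) t3 rt t12.
rewrite -(h_def x x0) -/C => M.
(* The moment is nonnegative because its differences are counts of primes. *)
rewrite ger0_norm; last first.
  rewrite mulr_ge0 ?invr_ge0 ?(ltW x0) //; apply: sumr_ge0 => n _.
  by rewrite h_def // prime_pi_diff ?exprn_ge0 // mulr_ge0 // ltW.
apply: le_trans M _; apply: le_trans (ler_wpM2l _ (ler_norm _)); last first.
  by rewrite mulr_ge0 //; lra.
rewrite [leRHS](_ : _ = 7 * (C * expR (A * ((r x)%:R * `|ln (ln (r x)%:R)|)))
   * (lambda x ^+ r x * (r x)%:R ^+ (2 * r x))); last by ring.
apply: ler_wpM2r; first by rewrite mulr_ge0 ?exprn_ge0 // ltW.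
by rewrite ler_wpM2l // HA // r_gt0.
Unshelve. all: by end_near.
Qed.
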